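(* Consider the multi-stage stochastic waste collection model $\mathcal{M}$ (described in the context) and let $z^{RH,1}$ be the objective value produced by the rolling horizon approach with $W=1$. There exists a (nonempty) class of instances of the model with selling price $R=0$ such that, for the instances in the class, $z^{RH,1}=-\infty$ even though model $\mathcal{M}$ is feasible.
   Context: **Index sets.** Let $N\ge 1$ and $T\ge 2$ be integers; $\mathcal{I}=\{0,1,\ldots,N\}$ ($0$ is the depot, the others are waste bins), $\mathcal{I}'=\{1,\ldots,N\}$, $\mathcal{T}=\{1,\ldots,T\}$ (stages), $\mathcal{T}'=\{1,\ldots,T-1\}$, $\mathcal{T}''=\{2,\ldots,T\}$. **Scenario tree.** For each $t\in\mathcal{T}$ there is a finite nonempty set $\mathcal{N}^t$ of nodes at stage $t$ (nodes at different stages are regarded as distinct); $\mathcal{N}^1$ consists of the root only, and the nodes of $\mathcal{N}^T$ are the leaves. Each $n\in\mathcal{N}^t$, $t\in\mathcal{T}''$, has a unique parent $pa(n)\in\mathcal{N}^{t-1}$. Each node $n$ has a probability $\pi^n$, with $\sum_{n\in\mathcal{N}^t}\pi^n=1$ for each $t$ (and the probability of a non-leaf node is the sum of the probabilities of its children). **Parameters.** $C\ge 0$: travelling cost per distance unit; $R\ge 0$: unit selling price of waste; $Q$: vehicle capacity; $B$: waste density; $M$: Big-M number, i.e. a suitable large constant; $d_{ij}$: distance from $i$ to $j$ ($i,j\in\mathcal{I}$); $E_i$: capacity of bin $i\in\mathcal{I}'$; $S_i^{init}$: fraction of the volume of bin $i$ filled with waste at stage $1$; $a_i^n\in[0,1]$: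 accumulation rate (fraction of the volume) of bin $i\in\mathcal{I}'$ at node $n\in\mathcal{N}^t$, $t\in\mathcal{T}''$. An instance is a choice of all these data together with $N$, $T$ and the scenario tree. **Decision variables.** $x_{ij}^t\in\{0,1\}$ ($i,j\in\mathcal{I}$, $i\ne j$, $t\in\mathcal{T}'$; arc $(i,j)$ is traversed at time $t+1$); $y_i^t\in\{0,1\}$ ($i\in\mathcal{I}'$, $t\in\mathcal{T}'$; bin $i$ is visited at time $t+1$); $f_{ij}^n\ge 0$ ($i\in\mathcal{I}'$, $j\in\mathcal{I}$, $i\ne j$, $n\in\mathcal{N}^t$, $t\in\mathcal{T}''$; waste flow); $w_i^n\ge 0$ ($i\in\mathcal{I}'$, $n\in\mathcal{N}^t$, $t\in\mathcal{T}''$; waste collected); $u_i^n\ge 0$ ($i\in\mathcal{I}'$, $n\in\mathcal{N}^t$, $t\in\mathcal{T}$; waste in the bin). **Model $\mathcal{M}$.** Maximize $$R\sum_{t\in\mathcal{T}''}\sum_{n\in\mathcal{N}^t}\pi^n\sum_{i\in\mathcal{I}'}w_i^n-C\sum_{t\in\mathcal{T}'}\sum_{i,j\in\mathcal{I},\,i\ne j}d_{ij}x_{ij}^t$$ subject to the following constraints. For all $n\in\mathcal{N}^t$, $t\in\mathcal{T}''$: - $\sum_{j\in\mathcal{I},j\ne i}f_{ij}^n-\sum_{j\in\mathcal{I}',j\ne i}f_{ji}^n=w_i^n$ for $i\in\mathcal{I}'$; - $f_{ij}^n\le (Q-E_jBa_j^n)x_{ij}^{t-1}$ for $i,j\in\mathcal{I}'$,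 $i\ne j$; - $f_{i0}^n\le Qx_{i0}^{t-1}$ for $i\in\mathcal{I}'$; - $f_{ij}^n\le Q-w_j^n$ for $i,j\in\mathcal{I}'$, $i\ne j$; - $f_{ij}^n\ge w_i^n-M(1-x_{ij}^{t-1})$ for $i\in\mathcal{I}'$, $j\in\mathcal{I}$, $i\ne j$; - $w_i^n\le E_iBy_i^{t-1}$ for $i\in\mathcal{I}'$; - $u_i^n\le M(1-y_i^{t-1})$ for $i\in\mathcal{I}'$; - $u_i^n=u_i^{pa(n)}+E_iBa_i^n-w_i^n$ for $i\in\mathcal{I}'$; - $u_i^{pa(n)}\le(1-a_i^n)E_iB$ for $i\in\mathcal{I}'$. For all $t\in\mathcal{T}'$: - $\sum_{j\in\mathcal{I},j\ne i}x_{ij}^t=y_i^t$ for $i\in\mathcal{I}'$; - $\sum_{i\in\mathcal{I},i\ne j}x_{ij}^t=y_j^t$ for $j\in\mathcal{I}'$; - $\sum_{i\in\mathcal{I}'}x_{i0}^t=\sum_{j\in\mathcal{I}'}x_{0j}^t$. At the root $n\in\mathcal{N}^1$: $u_i^n=E_iBS_i^{init}$ for $i\in\mathcal{I}'$. The binary and nonnegativity restrictions are as listed with the variables. Model $\mathcal{M}$ is feasible if there are values of the variables satisfying all constraints. **Rolling horizon approach.** Fix an integer $W$ with $1\le W<T-1$. For $k=1,2,\ldots,T-1$ in this order, put $l=\min(k+W,T)$ and solve to optimality the subproblem on stages $k,\ldots,l$: it is model $\mathcal{M}$ restricted to these stages, i.e. with variables $x^t,y^t$ for $t=k,\ldots,l-1$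 and $f^n,w^n,u^n$ for nodes at stages $k+1,\ldots,l$, objective consisting of the revenue terms of stages $k+1,\ldots,l$ minus the travelling cost terms of $t=k,\ldots,l-1$, the same constraints for these stages, and with the inventory levels $u_i^n$, $n\in\mathcal{N}^k$, fixed: to $E_iBS_i^{init}$ if $k=1$, and to the values stored at the previous iteration if $k\ge 2$. From the optimal solution found, store $x_{ij}^k$, $y_i^k$ and $w_i^n,u_i^n$ for $n\in\mathcal{N}^{k+1}$. After the $T-1$ subproblems have been solved, $z^{RH,W}$ is the value of the objective function of $\mathcal{M}$ at the stored $x_{ij}^t$ ($t\in\mathcal{T}'$) and $w_i^n$ ($n\in\mathcal{N}^t$, $t\in\mathcal{T}''$). If one of the subproblems is infeasible, $z^{RH,W}=-\infty$. No rule is prescribed for selecting among multiple optimal solutions of a subproblem; the value $z^{RH,W}$ refers to any such selection. *)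

(* Defs.v *)
From mathcomp Require Import all_boot all_order all_algebra.
From mathcomp Require Import reals constructive_ereal.

Set Implicit Arguments.
Unset Strict Implicit.
Unset Printing Implicit Defensive.

Import Order.TTheory GRing.Theory Num.Theory.
Local Open Scope ring_scope.

(** Locations are the elements of ['I_(nbins.+1)]: [ord0] is the depot and the
    waste bins are the [i != ord0].  The values of [bin_cap], [init_fill] and
    [accum] at the depot, of [accum] at the root, of [dist] on the diagonal and
    of [parent] at the root are irrelevant.
    The nodes of all stages form a single finite type; the set of nodes of
    stage [t] is [[pred n | stage n == t]]. *)
Record instance (R : realType) := Instance {
  nbins : nat;
  horizon : nat;
  node : finType;
  stage : node -> nat;
  parent : node -> node;
  prob : node -> R;
  travel_cost : R;
  price : R;
  capacity : R;
  density : R;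
  bigM : R;
  dist : 'I_nbins.+1 -> 'I_nbins.+1 -> R;
  bin_cap : 'I_nbins.+1 -> R;
  init_fill : 'I_nbins.+1 -> R;
  accum : node -> 'I_nbins.+1 -> R;

  nbins_ge1 : (1 <= nbins)%N;
  horizon_ge2 : (2 <= horizon)%N;

  stage_range : forall n, (1 <= stage n <= horizon)%N;
  stage_nonempty : forall t, (1 <= t <= horizon)%N -> exists n, stage n = t;
  root_unique : forall n m, stage n = 1%N -> stage m = 1%N -> n = m;
  stage_parent : forall n, (1 < stage n)%N -> stage n = (stage (parent n)).+1;
  nonleaf_child : forall n, (stage n < horizon)%N ->
    exists m, stage m = (stage n).+1 /\ parent m = n;

  prob_ge0 : forall n, 0 <= prob n;
  prob_stage : forall t, (1 <= t <= horizon)%N ->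
    \sum_(n | stage n == t) prob n = 1;
  prob_children : forall n, (stage n < horizon)%N ->
    prob n = \sum_(m | (stage m == (stage n).+1) && (parent m == n)) prob m;

  travel_cost_ge0 : 0 <= travel_cost;
  price_ge0 : 0 <= price;
  capacity_gt0 : 0 < capacity;
  density_gt0 : 0 < density;
  dist_ge0 : forall i j, i != j -> 0 <= dist i j;
  bin_cap_gt0 : forall i, i != ord0 -> 0 < bin_cap i;
  init_fill_range : forall i, i != ord0 -> 0 <= init_fill i <= 1;
  accum_range : forall n i, (1 < stage n)%N -> i != ord0 ->
    0 <= accum n i <= 1;
  (** "Suitably large": the waste collected from, and the waste in, bin [i] are
      at most [bin_cap i * density], so a big-M constraint whose binary
      variable switches it off excludes nothing. *)
  bigM_large : forall i, i != ord0 -> bin_cap i * density <= bigM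
}.

Notation loc I := 'I_(nbins I).+1.

(** Every function below is total; its values outside the index range of the
    corresponding decision variables are neither constrained nor used. *)
Record solution (R : realType) (I : instance R) := Solution {
  arc : nat -> loc I -> loc I -> bool;
  visit : nat -> loc I -> bool;
  flow : node I -> loc I -> loc I -> R;
  collected : node I -> loc I -> R;
  inventory : node I -> loc I -> R
}.

(** The constraints of the model restricted to stages [k, ..., l], with the
    inventory levels at the nodes of stage [k] fixed to [u0]. *)
Record feasible_on (R : realType) (I : instance R) (k l : nat)
    (u0 : node I -> loc I -> R) (s : solution I) : Prop := FeasibleOn {
  flow_conservation : forall n i, (k < stage n <= l)%N -> i != ord0 ->
    \sum_(j | j != i) flow s n i j - \sum_(j | (j != ord0) && (j != i)) flow s n j i
      = collected s n i;
  flow_le_bin : forall n i j, (k < stage n <= l)%N ->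
    i != ord0 -> j != ord0 -> i != j ->
    flow s n i j <= (capacity I - bin_cap j * density I * accum n j)
                   * (arc s (stage n).-1 i j)%:R;
  flow_le_depot : forall n i, (k < stage n <= l)%N -> i != ord0 ->
    flow s n i ord0 <= capacity I * (arc s (stage n).-1 i ord0)%:R;
  flow_le_residual : forall n i j, (k < stage n <= l)%N ->
    i != ord0 -> j != ord0 -> i != j ->
    flow s n i j <= capacity I - collected s n j;
  flow_ge : forall n i j, (k < stage n <= l)%N -> i != ord0 -> i != j ->
    collected s n i - bigM I * (1 - (arc s (stage n).-1 i j)%:R) <= flow s n i j;
  collect_le : forall n i, (k < stage n <= l)%N -> i != ord0 ->
    collected s n i <= bin_cap i * density I * (visit s (stage n).-1 i)%:R;
  inventory_emptied : forall n i, (k < stage n <= l)%N -> i != ord0 ->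
    inventory s n i <= bigM I * (1 - (visit s (stage n).-1 i)%:R);
  inventory_balance : forall n i, (k < stage n <= l)%N -> i != ord0 ->
    inventory s n i = inventory s (parent n) i + bin_cap i * density I * accum n i - collected s n i;
  no_overflow : forall n i, (k < stage n <= l)%N -> i != ord0 ->
    inventory s (parent n) i <= (1 - accum n i) * bin_cap i * density I;
  out_degree : forall t i, (k <= t < l)%N -> i != ord0 ->
    (\sum_(j | j != i) arc s t i j = visit s t i)%N;
  in_degree : forall t j, (k <= t < l)%N -> j != ord0 ->
    (\sum_(i | i != j) arc s t i j = visit s t j)%N;
  depot_degree : forall t, (k <= t < l)%N ->
    (\sum_(i | i != ord0) arc s t i ord0 = \sum_(j | j != ord0) arc s t ord0 j)%N;
  inventory_fixed : forall n i, stage n = k -> i != ord0 -> inventory s n i = u0 n i;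
  f_ge0 : forall n i j, (k < stage n <= l)%N -> i != ord0 -> i != j ->
    0 <= flow s n i j;
  w_ge0 : forall n i, (k < stage n <= l)%N -> i != ord0 -> 0 <= collected s n i;
  u_ge0 : forall n i, (k <= stage n <= l)%N -> i != ord0 -> 0 <= inventory s n i
}.

Definition objective (R : realType) (I : instance R) (k l : nat)
    (x : nat -> loc I -> loc I -> bool) (w : node I -> loc I -> R) : R :=
  price I * (\sum_(k.+1 <= t < l.+1) \sum_(n | stage n == t)
               prob n * \sum_(i | i != ord0) w n i)
  - travel_cost I * (\sum_(k <= t < l) \sum_i \sum_(j | j != i)
               dist i j * (x t i j)%:R).

Definition optimal_on (R : realType) (I : instance R) (k l : nat)
    (u0 : node I -> loc I -> R) (s : solution I) : Prop :=
  feasible_on k l u0 s /\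
  forall s', feasible_on k l u0 s' ->
    objective k l (arc s') (collected s') <= objective k l (arc s) (collected s).

Definition initial_inventory (R : realType) (I : instance R)
    (n : node I) (i : loc I) : R := bin_cap i * density I * init_fill i.

Definition model_feasible (R : realType) (I : instance R) : Prop :=
  exists s, feasible_on 1 (horizon I) (@initial_inventory R I) s.

(** In the rolling horizon approach, [sol k] is the optimal solution found for
    the [k]-th subproblem, from which the values of [arc] at stage [k] and of
    [collected] and [inventory] at the nodes of stage [k.+1] are stored. *)
Definition rh_inventory (R : realType) (I : instance R)
    (sol : nat -> solution I) (k : nat) : node I -> loc I -> R :=
  if k == 1%N then @initial_inventory R I else inventory (sol k.-1).

Definition rh_last (R : realType) (I : instance R) (W k : nat) : nat :=
  minn (k + W) (horizon I).

Definition rh_solved (R : realType) (I : instance R) (W : nat)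
    (sol : nat -> solution I) (k : nat) : Prop :=
  optimal_on k (rh_last I W k) (rh_inventory sol k) (sol k).

Definition rh_stored_x (R : realType) (I : instance R)
    (sol : nat -> solution I) : nat -> loc I -> loc I -> bool :=
  fun t => arc (sol t) t.

Definition rh_stored_w (R : realType) (I : instance R)
    (sol : nat -> solution I) : node I -> loc I -> R :=
  fun n => collected (sol (stage n).-1) n.

(** [rh_value I W z]: [z] is the value produced by the rolling horizon approach
    for some selection among the optimal solutions of the subproblems. *)
Inductive rh_value (R : realType) (I : instance R) (W : nat) : \bar R -> Prop :=
| rh_completed (sol : nat -> solution I) :
    (forall k, (1 <= k < horizon I)%N -> rh_solved W sol k) ->
    rh_value I W
      (objective 1 (horizon I) (rh_stored_x sol) (rh_stored_w sol))%:E
| rh_failed (sol : nat -> solution I) (k : nat) :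
    (1 <= k < horizon I)%N ->
    (forall j, (1 <= j < k)%N -> rh_solved W sol j) ->
    (forall s, ~ feasible_on k (rh_last I W k) (rh_inventory sol k) s) ->
    rh_value I W -oo%E.

(* Main.v *)
(** With price zero and one-stage subproblems, collecting waste costs money and
    brings nothing, so the first subproblem is solved uniquely by staying at
    the depot whenever nothing overflows at stage 2.  If the waste accumulated
    during the first two periods overfills some bin, the second subproblem is
    then infeasible, although the full model can empty that bin in time. *)
From mathcomp Require Import all_boot all_order all_algebra.
From mathcomp Require Import reals constructive_ereal.
From mathcomp Require Import lra.
Require Import Defs.

Set Implicit Arguments.
Unset Strict Implicit.
Unset Printing Implicit Defensive.

Import Order.TTheory GRing.Theory Num.Theory.
Local Open Scope ring_scope.

(** Strict positivity of the cost and of the distances makes idling the only optimum of the first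
    subproblem. [overflow_stage2] ranges over all nodes because idling must be feasible; in
    [overflow_stage3] a single overfull bin at a single node already breaks feasibility. *)
Record delayed_overflow (R : realType) (I : instance R) : Prop := DelayedOverflow {
  overflow_price : price I = 0;
  overflow_horizon : (2 < horizon I)%N;
  overflow_cost : 0 < travel_cost I;
  overflow_dist : forall i j : loc I, i != j -> 0 < dist i j;
  overflow_feasible : model_feasible I;
  overflow_stage2 : forall (n : node I) i, stage n = 2%N -> i != ord0 ->
    init_fill i + accum n i <= 1;
  overflow_stage3 : exists (m : node I) i, [/\ stage m = 3%N, i != ord0 &
    1 < init_fill i + accum (parent m) i + accum m i]
}.

Lemma objective1_price0 (R : realType) (I : instance R) k x (w : node I -> loc I -> R) :
  price I = 0 ->
  objective k k.+1 x w =
    - (travel_cost I * \sum_i \sum_(j | j != i) dist i j * (x k i j)%:R).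
Proof. by move=> p0; rewrite /objective p0 mul0r add0r big_nat1. Qed.

(** The inventory is the true waste level at stages 1 and 2 only, the range of the first subproblem.
    The case split discards the arbitrary value of [accum] at the root. *)
Definition idle_solution (R : realType) (I : instance R) : solution I :=
  @Solution R I (fun _ _ _ => false) (fun _ _ => false) (fun _ _ _ => 0)
    (fun _ _ => 0)
    (fun n i => bin_cap i * density I *
                (init_fill i + (if stage n == 1%N then 0 else accum n i))).

Lemma bin_volume_gt0 (R : realType) (I : instance R) (i : loc I) :
  i != ord0 -> 0 < bin_cap i * density I.
Proof. by move=> i0; rewrite mulr_gt0 ?bin_cap_gt0 ?density_gt0. Qed.

Lemma idle_feasible (R : realType) (I : instance R) :
  (forall (n : node I) i, stage n = 2%N -> i != ord0 ->
     init_fill i + accum n i <= 1) ->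
  feasible_on 1 2 (@initial_inventory R I) (idle_solution I).
Proof.
move=> fill2.
have stage2 (n : node I) : (1 < stage n <= 2)%N -> stage n = 2%N.
  by move=> n2; apply/eqP; rewrite eqn_leq andbC.
have stageP (n : node I) : stage n = 2%N -> stage (parent n) = 1%N.
  by move=> n2; have := stage_parent (n := n); rewrite n2 => /(_ isT) [].
have M0 (i : loc I) : i != ord0 -> 0 <= bigM I.
  move=> i0; apply: le_trans (bigM_large i0).
  exact: ltW (bin_volume_gt0 i0).
split=> /=.
- by move=> n i _ _; rewrite !big1 ?subr0.
- by move=> *; rewrite mulr0.
- by move=> *; rewrite mulr0.
- by move=> *; rewrite subr0 ltW ?capacity_gt0.
- by move=> n i j _ /M0; rewrite subr0 mulr1 sub0r oppr_le0.
- by move=> *; rewrite mulr0.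
(* An unvisited bin faces the bound [bigM], which dominates its volume, and [fill2] keeps its
   content within that volume. *)
- move=> n i /stage2 n2 i0; rewrite n2 /= subr0 mulr1.
  apply: le_trans (bigM_large i0); rewrite ler_piMr ?fill2 //.
  exact: ltW (bin_volume_gt0 i0).
- by move=> n i /stage2 n2 i0; rewrite (stageP _ n2) n2 /= addr0 subr0 mulrDr.
- move=> n i /stage2 n2 i0; rewrite (stageP _ n2) /= addr0.
  rewrite -[leRHS]mulrA [leRHS]mulrC (ler_pM2l (bin_volume_gt0 i0)).
  by rewrite lerBrDr fill2.
- by move=> *; rewrite big1.
- by move=> *; rewrite big1.
- by move=> *; rewrite !big1.
- by move=> n i -> _; rewrite eqxx addr0.
- by [].
- by [].
- move=> n i /andP[n1 _] i0; apply: mulr_ge0.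
    exact: ltW (bin_volume_gt0 i0).
  have /andP[s0 _] := init_fill_range i0.
  case: eqP => [_|/eqP n_neq1]; first by rewrite addr0.
  have /(accum_range (i := i))/(_ i0)/andP[a0 _] : (1 < stage n)%N.
    by rewrite ltn_neqAle eq_sym n_neq1.
  exact: addr_ge0.
Qed.

(** At price zero the objective is minus a sum of nonnegative travel costs, and idling attains 0. An
    optimal sum is therefore 0, so each of its terms vanishes, and a positive distance forces the
    arc to be off. *)
Lemma optimal_idle (R : realType) (I : instance R) (s : solution I) :
  delayed_overflow I -> optimal_on 1 2 (@initial_inventory R I) s ->
  forall i j, i != j -> arc s 1 i j = false.
Proof.
move=> K [_ sopt] i j ij.
have := sopt _ (idle_feasible (overflow_stage2 K)).
rewrite !objective1_price0 ?(overflow_price K) //=.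
rewrite [X in - (_ * X) <= _]big1; last first.
  by move=> a _; rewrite big1 // => b _; rewrite mulr0.
rewrite mulr0 oppr0 oppr_ge0 (pmulr_rle0 _ (overflow_cost K)) => sum_le0.
have term_ge0 a b : b != a -> 0 <= dist a b * (arc s 1 a b)%:R.
  by move=> ba; rewrite mulr_ge0 ?ler0n ?ltW ?(overflow_dist K) // eq_sym.
have row_ge0 a : true -> 0 <= \sum_(b | b != a) dist a b * (arc s 1 a b)%:R.
  by move=> _; apply: sumr_ge0 => b; apply: term_ge0.
have sum0 : \sum_a \sum_(b | b != a) dist a b * (arc s 1 a b)%:R = 0.
  by apply/eqP; rewrite eq_le sum_le0 sumr_ge0.
have row0 : \sum_(b | b != i) dist i b * (arc s 1 i b)%:R = 0.
  by apply: (psumr_eq0P row_ge0 sum0).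
have ji : j != i by rewrite eq_sym.
have /eqP : dist i j * (arc s 1 i j)%:R = 0.
  by apply: (psumr_eq0P (term_ge0 i) row0).
by rewrite mulf_eq0 gt_eqF ?(overflow_dist K) //= pnatr_eq0 eqb0 => /negPf.
Qed.

(** Without outgoing arcs the degree constraint leaves every bin unvisited, so nothing is collected
    and the balance equation only adds the accumulation. *)
Lemma optimal_inventory (R : realType) (I : instance R) (s : solution I) :
  delayed_overflow I -> optimal_on 1 2 (@initial_inventory R I) s ->
  forall n i, stage n = 2%N -> i != ord0 ->
  inventory s n i = bin_cap i * density I * (init_fill i + accum n i).
Proof.
move=> K s_opt n i n2 i0; have s_feas := s_opt.1.
have n_in : (1 < stage n <= 2)%N by rewrite n2.
have unvisited : visit s 1 i = false.
  apply/negbTE; rewrite -eqb0 -(out_degree s_feas (t := 1)) // big1 // => j ji.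
  by rewrite (optimal_idle K s_opt) // eq_sym.
have w0 : collected s n i = 0.
  apply/eqP; rewrite eq_le (w_ge0 s_feas) // andbT.
  by have := collect_le s_feas n_in i0; rewrite n2 unvisited mulr0.
have root_parent : stage (parent n) = 1%N.
  by have := stage_parent (n := n); rewrite n2 => /(_ isT) [].
by rewrite (inventory_balance s_feas) // w0 subr0 (inventory_fixed s_feas) // mulrDr.
Qed.

(** The inventory stored after the first subproblem is forced, and with it [no_overflow] fails at
    the overfull node of stage 3: the waste is already in the bin before the vehicle can act. *)
Lemma rh_second_infeasible (R : realType) (I : instance R) (sol : nat -> solution I) :
  delayed_overflow I -> rh_solved 1 sol 1 ->
  forall s, ~ feasible_on 2 (rh_last I 1 2) (rh_inventory sol 2) s.
Proof.
move=> K; have T3 := overflow_horizon K.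
rewrite /rh_solved /rh_last /rh_inventory /= (minn_idPl T3).
rewrite (minn_idPl (ltnW T3)) => s_opt s s_feas.
have [m [i [m3 i0 overfull]]] := overflow_stage3 K.
have p2 : stage (parent m) = 2%N.
  by have := stage_parent (n := m); rewrite m3 => /(_ isT) [].
have m_in : (2 < stage m <= 3)%N by rewrite m3.
have := no_overflow s_feas m_in i0.
rewrite (inventory_fixed s_feas) // (optimal_inventory K s_opt) //.
rewrite -[leRHS]mulrA [leRHS]mulrC (ler_pM2l (bin_volume_gt0 i0)).
by lra.
Qed.

(** A completed run would solve the infeasible second subproblem. Conversely, the value is attained
    only if some run reaches that failure, so an optimal solution of the first subproblem must be
    exhibited. *)
Lemma delayed_overflow_rh_value (R : realType) (I : instance R) (z : \bar R) :
  delayed_overflow I -> rh_value I 1 z <-> z = -oo%E.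
Proof.
move=> K; have T3 := overflow_horizon K; split=> [|->].
  case=> // sol solved.
  have s1 : rh_solved 1 sol 1 by apply: solved; rewrite (ltnW T3).
  have s2 : rh_solved 1 sol 2 by apply: solved; rewrite T3.
  by case: (rh_second_infeasible K s1 s2.1).
pose sol (_ : nat) := idle_solution I.
have s1 : rh_solved 1 sol 1.
  rewrite /rh_solved /rh_last (minn_idPl (ltnW T3)).
  split; first exact/idle_feasible/(overflow_stage2 K).
  move=> s' _; rewrite !objective1_price0 ?(overflow_price K) //=.
  rewrite [X in _ <= - (_ * X)]big1; last first.
    by move=> a _; rewrite big1 // => b _; rewrite mulr0.
  rewrite mulr0 oppr0 oppr_le0 mulr_ge0 ?(ltW (overflow_cost K)) //.
  apply: sumr_ge0 => a _; apply: sumr_ge0 => b ba.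
  by rewrite mulr_ge0 ?ler0n ?dist_ge0 // eq_sym.
apply: (@rh_failed _ _ _ sol 2); first by rewrite T3.
  by move=> [|[|j]].
exact: rh_second_infeasible.
Qed.

(** One bin, initially empty, that fills up completely in every period. *)
Lemma one_bin_instance (R : realType) : exists I : instance R, delayed_overflow I.
Proof.
have bin_unique (i j : 'I_2) : i != ord0 -> j != ord0 -> i = j.
  by case: i j => [[|[|i]] ?] [[|[|j]] ?] //= _ _; apply: val_inj.
have parentK (n : 'I_3) : (inord n.-1 : 'I_3) = n.-1 :> nat.
  by rewrite inordK // (leq_ltn_trans (leq_pred n)).
(* The scenario tree is a path with one node per stage, the root being its own [parent]. Price and
   initial fill are 0; every other parameter is 1, so the vehicle holds exactly one full bin. *)
unshelve eexists; first unshelve refine (@Instance R 1 3 'I_3 (fun n => n.+1)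
  (fun n => inord n.-1) (fun=> 1) 1 0 1 1 1 (fun _ _ => 1) (fun=> 1) (fun=> 0)
  (fun _ _ => 1) _ _ _ _ _ _ _ _ _ _ _ _ _ _ _ _ _ _ _) => //=.
- by move=> [|t] // t3; exists (Ordinal t3).
- by move=> n m [n0] [m0]; apply: val_inj; rewrite /= n0 m0.
- by move=> n n1; rewrite parentK prednK.
- move=> n n3; exists (Ordinal n3); split=> //=.
  by apply: val_inj; rewrite /= inordK //= ltnW.
- by move=> [|t] // t3; rewrite (big_pred1 (Ordinal t3)).
- move=> n n3; rewrite (big_pred1 (Ordinal n3)) // => m /=.
  rewrite eqSS; apply/andP/eqP => [[/eqP m_n _]|->]; first exact: val_inj.
  by split=> //; apply/eqP/val_inj; rewrite /= inordK // ltnW.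
- by move=> *; rewrite lexx ler01.
- by move=> *; rewrite lexx ler01.
- by rewrite mulr1.
have others_bin (i : 'I_2) : i != ord0 -> forall j, (j != ord0) && (j != i) = false.
  by move=> i0 j; apply/negP => /andP[j0 /eqP]; apply; apply: bin_unique.
have other (i : 'I_2) : exists j, forall k, (k != i) = (k == j).
  exists (rev_ord i) => k.
  by case: i k => [[|[|i]] ?] [[|[|k]] ?].
have bin1 : forall k : 'I_2, (k != ord0) = (k == ord_max).
  by move=> [[|[|k]] ?].
split=> //=.
(* Emptying the bin in every period: on two locations, all arcs on means the round trip from the
   depot to the bin and back. *)
- exists (@Solution R _ (fun _ _ _ => true) (fun _ _ => true)
    (fun _ _ _ => 1) (fun _ _ => 1) (fun _ _ => 0)).
  split=> /=.
  + move=> n i _ i0; rewrite [X in _ - X]big_pred0 ?subr0; last exact: others_bin.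
    by have [j ij] := other i; rewrite (big_pred1 j).
  (* Vacuous, since there are no two distinct bins. *)
  + by move=> n i j _ i0 j0; rewrite (bin_unique _ _ i0 j0) eqxx.
  + by move=> *; rewrite mulr1.
  + by move=> n i j _ i0 j0; rewrite (bin_unique _ _ i0 j0) eqxx.
  + by move=> *; rewrite subrr mulr0 subr0.
  + by move=> *; rewrite !mulr1.
  + by move=> *; rewrite subrr mulr0.
  + by move=> *; rewrite !mulr1 add0r subrr.
  + by move=> *; rewrite subrr !mul0r.
  + by move=> t i _ _; have [j ij] := other i; rewrite (big_pred1 j).
  + by move=> t i _ _; have [j ij] := other i; rewrite (big_pred1 j).
  + by move=> *; rewrite !(big_pred1 ord_max).
  + by move=> *; rewrite /initial_inventory mulr0.
  + by move=> *; exact: ler01.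
  + by move=> *; exact: ler01.
  + by [].
- by move=> *; rewrite add0r.
(* The leaf and the bin: two periods of accumulation give 2 > 1. *)
- exists ord_max, ord_max; split=> //; lra.
Qed.

Theorem theorem4p2 (R : realType) :
  exists K : instance R -> Prop,
    (exists I, K I) /\
    (forall I, K I ->
       [/\ price I = 0%R,
           (1 < horizon I - 1)%N,
           model_feasible I
         & forall z : \bar R, rh_value I 1 z <-> z = -oo%E]).
Proof.
exists (@delayed_overflow R); split; first exact: one_bin_instance.
move=> I K; split.
- exact: overflow_price K.
(* The admissibility condition [W < T - 1] at [W = 1]. *)
- by rewrite ltn_subRL; exact: overflow_horizon K.
- exact: overflow_feasible K.
- by move=> z; exact: delayed_overflow_rh_value.
Qed.
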